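(* Let $L$ be a link in $\mathbb{R}^3$ and let $[[L]]$ be its link-homotopy class. Among all curves in $[[L]]$ with link-thickness at least $1$, there is some $L_0$ of minimum length.
   Context: A curve is a continuous map $M\to\mathbb{R}^3$ from a compact oriented 1-manifold with boundary (finitely many components), up to orientation-preserving reparametrization. A link is a closed curve (all components of $M$ are circles) whose different components have disjoint images (a component may intersect itself). The link-homotopy class $[[L]]$ is the set of closed curves homotopic to $L$ through configurations in which different components stay disjoint (each component may intersect itself during the homotopy). The link-thickness of a curve is the minimum distance between points on different components. Length is the supremum of the lengths of inscribed polygons. *)

(* Defs.v *)
From HB Require Import structures.
From mathcomp Require Import all_boot all_order all_algebra all_fingroup.
From mathcomp Require Import all_classical all_reals all_analysis.

Set Implicit Arguments.
Unset Strict Implicit.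
Unset Printing Implicit Defensive.

Import Order.TTheory GRing.Theory Num.Theory.
Import numFieldNormedType.Exports.

Local Open Scope classical_set_scope.
Local Open Scope ring_scope.

(* The norm `|u| of MathComp-Analysis on 'rV[R]_3 is the sup norm: it induces
   the right topology, but distances and lengths have to be Euclidean. *)
Definition eucl_dist (R : realType) (u v : 'rV[R]_3) : R :=
  Num.sqrt (\sum_i (u 0 i - v 0 i) ^+ 2).

(* A parametrized closed curve with n components, i.e. a continuous map from a
   disjoint union of n circles to R^3. The circle is R/Z, oriented by R, and a
   continuous map on R/Z is a continuous 1-periodic map on R. *)
Record closed_curve (R : realType) (n : nat) := ClosedCurve {
  component :> 'I_n -> R -> 'rV[R]_3;
  component_continuous : forall i, continuous (component i);
  component_periodic : forall i, periodic (component i) 1 }.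

(* f and g are the same closed curve up to an orientation-preserving
   homeomorphism of the disjoint union of n circles. Such a homeomorphism
   permutes the circles and, from each circle to its image, lifts to a
   continuous increasing map phi i of R commuting with the translation by 1. *)
Definition reparametrization (R : realType) (n : nat) (f g : closed_curve R n) :=
  exists (sigma : 'S_n) (phi : 'I_n -> R -> R),
    [/\ forall i, continuous (phi i),
        forall i, {homo phi i : s t / s < t},
        forall i t, phi i (t + 1) = phi i t + 1 &
        forall i t, f i t = g (sigma i) (phi i t)].

Definition is_link (R : realType) (n : nat) (f : closed_curve R n) :=
  forall i j, i != j -> range (f i) `&` range (f j) = set0.

Definition link_homotopy (R : realType) (n : nat) (H : R -> closed_curve R n) :=
  (forall i, {within `[0, 1] `*` [set: R],
     continuous (fun p : R * R => H p.1 i p.2)}) /\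
  (forall s, s \in `[0, 1] -> is_link (H s)).

(* Curves are considered up to reparametrization, so the two ends of the
   homotopy are arbitrary parametrizations of L and K. *)
Definition link_homotopy_class (R : realType) (n : nat) (L : closed_curve R n) :
    set (closed_curve R n) :=
  [set K | exists H : R -> closed_curve R n,
     [/\ link_homotopy H, reparametrization (H 0) L &
         reparametrization (H 1) K]].

(* With fewer than two components the set of distances is empty and the
   thickness is +oo. *)
Definition link_thickness (R : realType) (n : nat) (f : closed_curve R n) :
    \bar R :=
  ereal_inf [set x | exists i j s t,
    i != j /\ x = (eucl_dist (f i s) (f j t))%:E].

(* The length of the polygon with vertices f a, f t_1, ..., f t_k, where
   s = [:: t_1; ...; t_k]. *)
Definition polygon_length (R : realType) (f : R -> 'rV[R]_3) (a : R) (s : seq R) :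
    R :=
  \sum_(d <- pairmap (fun t u => eucl_dist (f t) (f u)) a s) d.

(* A polygon inscribed in a closed curve is a closed polygon in each component:
   for the i-th one it starts at the parameter a i, goes once around the circle
   and ends at a i + 1, that is, at the same point. *)
Definition curve_length (R : realType) (n : nat) (f : closed_curve R n) : \bar R :=
  ereal_sup [set x | exists (a : 'I_n -> R) (s : 'I_n -> seq R),
    (forall i, itv_partition (a i) (a i + 1) (s i)) /\
    x = (\sum_i polygon_length (f i) (a i) (s i))%:E].

(* Main.v *)
Require Import Defs.
From mathcomp Require Import all_boot all_order all_algebra all_fingroup.
From mathcomp Require Import all_classical all_reals all_analysis.
From mathcomp Require Import ring lra.

Set Implicit Arguments.
Unset Strict Implicit.
Unset Printing Implicit Defensive.

Import Order.TTheory GRing.Theory Num.Theory.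
Import numFieldNormedType.Exports.

Local Open Scope classical_set_scope.
Local Open Scope ring_scope.

(** The proof is the direct method of the calculus of variations. The class
   contains a curve of thickness at least [1], because a link has positive
   thickness and may be expanded ([link_class_has_thick]). Take curves of the
   class, of thickness at least [1], whose lengths tend to the infimum, which may
   be assumed finite. A subsequence should converge to the minimizer, but this
   requires control on two symmetries of the problem.

   Parametrizations are tamed by arc length: a curve of length at most [M] is a
   reparametrization of a Lipschitz curve, with a constant that depends on [M]
   only ([lipschitz_reparametrization]). Arc length itself may be constant on
   intervals; adding the parameter to it makes it invertible. It is
   moreover replaced by the sum of the total variations of the coordinates, which
   inherit the continuity of the curve.

   Translations are a more serious matter, because different pieces of a split
   link can be carried arbitrarily far from each other without changing the
   class, the length, or the lower bound on the thickness. Conversely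
   ([gather]), since the components have bounded diameter, distant groups of
   components can be brought back by rigid motions during which the thickness
   stays at least [1], until the whole curve lies in a ball whose radius depends
   on the length and on the number of components only.

   The normalized sequence is bounded and equi-Lipschitz
   ([normalized_representative]), so it converges pointwise along an ultrafilter
   that contains the neighbourhoods of infinity. The bounds on the Lipschitz
   constant and on the thickness are conditions on pairs of points and pass to the
   pointwise limit; length is lower semicontinuous, being a supremum of lengths of
   polygons ([limit_length]). Finally the convergence is uniform
   ([limit_uniform]), and a curve of thickness at least [1] can be deformed
   along segments to any curve at uniform distance less than [1/2] from it without
   two components meeting, so that the limit stays in the class
   ([limit_class]). *)

(** * Euclidean norm *)

Definition enorm (R : realType) (u : 'rV[R]_3) : R :=
  Num.sqrt (\sum_i (u 0 i) ^+ 2).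

Section euclidean_norm.
Variable R : realType.
Implicit Types (u v w : 'rV[R]_3) (a : R).

Lemma eucl_distE u v : eucl_dist u v = enorm (u - v).
Proof.
by rewrite /eucl_dist /enorm; congr Num.sqrt; apply: eq_bigr => i _; rewrite !mxE.
Qed.

Lemma sum_sqr_ge0 u : 0 <= \sum_i (u 0 i) ^+ 2.
Proof. by apply: sumr_ge0 => i _; rewrite sqr_ge0. Qed.

Lemma enorm_ge0 u : 0 <= enorm u.
Proof. exact: sqrtr_ge0. Qed.

Lemma enormZ a u : enorm (a *: u) = `|a| * enorm u.
Proof.
rewrite /enorm -sqrtr_sqr -sqrtrM ?sqr_ge0// mulr_sumr.
by congr Num.sqrt; apply: eq_bigr => i _; rewrite !mxE exprMn.
Qed.

Lemma enormN u : enorm (- u) = enorm u.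
Proof. by rewrite -scaleN1r enormZ normrN1 mul1r. Qed.

Lemma enorm0 : enorm (0 : 'rV[R]_3) = 0.
Proof. by rewrite -(scale0r 0) enormZ normr0 mul0r. Qed.

Lemma enormB u v : enorm (u - v) = enorm (v - u).
Proof. by rewrite -enormN opprB. Qed.

(** By Lagrange's identity, the difference of the squares is the squared norm of
   the cross product. *)
Lemma cauchy_schwarz u v : \sum_i u 0 i * v 0 i <= enorm u * enorm v.
Proof.
rewrite /enorm -sqrtrM ?sum_sqr_ge0//.
apply: le_trans (ler_norm _) _; rewrite -sqrtr_sqr ler_sqrt; last first.
  by rewrite mulr_ge0// sum_sqr_ge0.
rewrite !big_ord_recl !big_ord0 /=.
set a := u _ _; set b := u _ _; set c := u _ _.
set x := v _ _; set y := v _ _; set z := v _ _.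
rewrite -subr_ge0 [X in 0 <= X](_ : _ =
  (a * y - b * x) ^+ 2 + (a * z - c * x) ^+ 2 + (b * z - c * y) ^+ 2).
  by rewrite !addr_ge0// sqr_ge0.
by ring.
Qed.

Lemma enormD u v : enorm (u + v) <= enorm u + enorm v.
Proof.
rewrite -(ler_pXn2r (n := 2))// ?nnegrE ?addr_ge0 ?enorm_ge0//.
rewrite sqrrD {1 2 4}/enorm !sqr_sqrtr ?sum_sqr_ge0//.
have -> : \sum_i (u + v) 0 i ^+ 2 =
    \sum_i u 0 i ^+ 2 + (\sum_i u 0 i * v 0 i) *+ 2 + \sum_i v 0 i ^+ 2.
  rewrite -sumrMnl -!big_split/=; apply: eq_bigr => i _.
  by rewrite !mxE sqrrD.
by rewrite lerD2r lerD2l lerMn2r/= cauchy_schwarz.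
Qed.

Lemma enorm_triangle u v w : enorm (u - w) <= enorm (u - v) + enorm (v - w).
Proof. by rewrite (le_trans _ (enormD _ _))// addrA subrK. Qed.

Lemma enorm_lerB u v : enorm u - enorm v <= enorm (u - v).
Proof. by rewrite lerBlDr (le_trans _ (enormD _ _))// subrK. Qed.

Lemma coord_le_enorm u i : `|u 0 i| <= enorm u.
Proof.
rewrite -sqrtr_sqr /enorm ler_sqrt ?sum_sqr_ge0// (bigD1 i)//= lerDl.
by apply: sumr_ge0 => j _; rewrite sqr_ge0.
Qed.

Lemma enorm_le_sum u : enorm u <= \sum_i `|u 0 i|.
Proof.
have s0 (i : 'I_3) : 0 <= `|u 0 i| by [].
have S0 : 0 <= \sum_i `|u 0 i| by apply: sumr_ge0.
rewrite -(ler_pXn2r (n := 2))// ?nnegrE ?enorm_ge0//.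
rewrite /enorm sqr_sqrtr ?sum_sqr_ge0// expr2 mulr_suml.
apply: ler_sum => i _; rewrite -(real_normK (num_real _)) expr2 ler_wpM2l//.
by rewrite (bigD1 i)//= lerDl sumr_ge0.
Qed.

Lemma norm_le_enorm u : `|u| <= enorm u.
Proof.
rewrite [leLHS]/Num.norm/= mx_normrE; apply: bigmax_le; first exact: enorm_ge0.
by move=> [i j] _ /=; rewrite (ord1 i) coord_le_enorm.
Qed.

(** Together with [norm_le_enorm], this makes the Euclidean norm compatible with
   the topology, which comes from the sup norm. *)
Lemma enorm_le_norm u : enorm u <= 3 * `|u|.
Proof.
apply: le_trans (enorm_le_sum _) _.
have -> : 3 * `|u| = \sum_(i < 3) `|u| by rewrite sumr_const card_ord mulr_natl.
by apply: ler_sum => i _; rewrite [leRHS]/Num.norm/= mx_normrE;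
  apply/bigmax_geP; right; exists (0, i).
Qed.

Lemma enorm_eq0 u : enorm u = 0 -> u = 0.
Proof. by move=> u0; apply/eqP; rewrite -normr_le0 -u0 norm_le_enorm. Qed.

Lemma enorm_continuous : continuous (@enorm R).
Proof.
move=> u; apply/(@cvgrPdist_lt _ _ _ (nbhs u)) => e e0.
have e3 : 0 < 3^-1 * e by rewrite mulr_gt0.
have : \forall v \near u, `|u - v| < 3^-1 * e.
  by apply/nbhs_normP; exists (3^-1 * e).
apply: filterS => v uv.
have : enorm (u - v) < e.
  by apply: le_lt_trans (enorm_le_norm _) _; rewrite -ltr_pdivlMl.
apply: le_lt_trans; rewrite ler_norml enorm_lerB andbT lerNl opprB.
by rewrite enormB enorm_lerB.
Qed.

Lemma lipschitz_continuous (f : R -> 'rV[R]_3) a :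
  (forall s t, enorm (f s - f t) <= a * `|s - t|) -> continuous f.
Proof.
move=> fa t; apply/cvgrPdist_lt => e e0; near=> s.
apply: le_lt_trans (norm_le_enorm _) _; apply: le_lt_trans (fa _ _) _.
have : (`|a| + 1) * `|t - s| < e.
  rewrite -ltr_pdivlMl ?ltr_wpDl//.
  near: s; apply/nbhs_normP; exists ((`|a| + 1)^-1 * e) => //=.
  by rewrite mulr_gt0// invr_gt0 ltr_wpDl.
apply: le_lt_trans; rewrite ler_wpM2r//.
by rewrite (le_trans (ler_norm _))// lerDl.
Unshelve. all: by end_near. Qed.

End euclidean_norm.

(** * Links, thickness and the link-homotopy class *)

Section link_homotopy_class.
Variables (R : realType) (n : nat).
Implicit Types (f g h K L : closed_curve R n).

Lemma is_linkP f :
  is_link f <-> forall i j s t, i != j -> f i s <> f j t.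
Proof.
split=> [lf i j s t ij fe|lf i j ij].
  have : (range (f i) `&` range (f j)) (f i s) by split; [exists s|exists t].
  by rewrite lf.
by rewrite -subset0 => x [[s _ <-] [t _ /esym]]; exact: lf.
Qed.

Lemma thickness_ge1P f : (1 <= link_thickness f)%E <->
  forall i j s t, i != j -> 1 <= enorm (f i s - f j t).
Proof.
split=> [f1 i j s t ij|f1].
  rewrite -eucl_distE -lee_fin (le_trans f1)//; apply: ereal_inf_lbound.
  by exists i, j, s, t.
by apply/le_ereal_inf_tmp => x [i [j [s [t [ij ->]]]]]; rewrite lee_fin eucl_distE f1.
Qed.

Lemma reparametrization_ext f g :
  (forall i t, f i t = g i t) -> reparametrization f g.
Proof.
move=> fg; exists 1%g, (fun=> id); split=> // [i t|i x y //|i t]; first exact: cvg_id.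
by rewrite perm1.
Qed.

Lemma reparametrization_trans f g h :
  reparametrization f g -> reparametrization g h -> reparametrization f h.
Proof.
move=> [s [p [pc pm p1 fE]]] [s' [p' [pc' pm' p1' gE]]].
exists (s * s')%g, (fun i => p' (s i) \o p i); split=> //=.
- by move=> i t; apply: continuous_comp; [exact: pc|exact: pc'].
- by move=> i x y xy; apply: pm'; apply: pm.
- by move=> i t; rewrite p1 p1'.
- by move=> i t; rewrite fE gE permM.
Qed.

Lemma link_class_reparametrization L K K' :
  link_homotopy_class L K -> reparametrization K K' -> link_homotopy_class L K'.
Proof.
by move=> [H [HH H0 H1]] KK'; exists H; split=> //; exact: reparametrization_trans KK'.
Qed.

Lemma link_class_refl L : is_link L -> link_homotopy_class L L.
Proof.
move=> lL; exists (fun=> L); split; [split=> //| |]; try exact: reparametrization_ext.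
move=> i; apply: continuous_subspaceT => p.
by apply: (@continuous_comp _ _ _ snd (L i)); [exact: cvg_snd|exact: component_continuous].
Qed.

(** Every nonconstant homotopy below is produced in this way. The given
   homotopy to [K] is followed by the straight one from [K] to [K'], and
   concatenating them needs no case distinction on the time: the first one is
   frozen at time [1] once [s] passes [1/2], and the second one is an increment
   that vanishes before [1/2]. The homotopy to [K] ends at [K] only up to a
   reparametrization, given by [sg] and [p], which is also applied to the
   straight one. *)
Lemma link_class_straight_line L K K' :
  link_homotopy_class L K ->
  (forall s, 0 <= s <= 1 -> forall i j x y, i != j ->
     K i x + s *: (K' i x - K i x) <> K j y + s *: (K' j y - K j y)) ->
  link_homotopy_class L K'.
Proof.
move=> [H [[Hc Hl] H0 [sg [p [pc pm p1 HK]]]]] KK'.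
pose c1 (s : R) := Num.min 1 (2 * s); pose c2 (s : R) := Num.max 0 (2 * s - 1).
have c1c : continuous c1.
  move=> s; have d2 : {for s, continuous (fun x : R => 2 * x)}.
    by apply: cvgMr; exact: cvg_id.
  exact: (continuous_min (cvg_cst _) d2).
have c2c : continuous c2.
  move=> s; have d2 : {for s, continuous (fun x : R => 2 * x - 1)}.
    by apply: cvgB; [apply: cvgMr; exact: cvg_id|exact: cvg_cst].
  exact: (continuous_max (cvg_cst _) d2).
pose D i t := K' (sg i) (p i t) - K (sg i) (p i t).
have Dc i : continuous (D i).
  move=> t; apply: cvgB;
    by apply: (@continuous_comp _ _ _ (p i));
      [exact: pc|exact: component_continuous].
pose g s i t := H (c1 s) i t + c2 s *: D i t.
have gc s i : continuous (g s i).
  move=> t; apply: cvgD; first exact: component_continuous.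
  by apply: cvgZr; exact: Dc.
have gp s i : periodic (g s i) 1.
  by move=> t; rewrite /g /D p1 !component_periodic.
exists (fun s => ClosedCurve (gc s) (gp s)); split; [split| |].
- move=> i; apply/subspace_continuousP => -[s t] [/= s01 _].
  apply: cvgD.
    have /subspace_continuousP /(_ (c1 s, t)) := Hc i.
    have c01 x : `[0, 1]%classic x -> `[0, 1]%classic (c1 x).
      rewrite /= !in_itv/= /c1 => /andP[x0 x1].
      by rewrite ge_min lexx le_min ler01 mulr_ge0.
    move=> /(_ (conj (c01 _ s01) I)) Hcs.
    apply: (@cvg_comp _ _ _ (fun q : R * R => (c1 q.1, q.2)) _ _ _ _ _ Hcs).
    have : (fun q : R * R => (c1 q.1, q.2)) @ nbhs (s, t) --> nbhs (c1 s, t).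
      apply: (@cvg_pair _ _ _ (nbhs (s, t)) (nbhs (c1 s)) (nbhs t) _ _ _ (c1 \o fst) snd) => /=.
        by apply: (@continuous_comp _ _ _ fst c1 (s, t)); [exact: cvg_fst|exact: c1c].
      exact: cvg_snd.
    move=> cc P /cc; rewrite /nbhs/= /within/=; apply: filterS.
    by move=> q Pq [q1 q2]; apply: Pq; split => //; exact: c01.
  apply: cvg_within_filter; apply: cvgZ.
    by apply: (@continuous_comp _ _ _ fst c2 (s, t)); [exact: cvg_fst|exact: c2c].
  by apply: (@continuous_comp _ _ _ snd (D i) (s, t)); [exact: cvg_snd|exact: Dc].
- move=> s; rewrite in_itv/= => /andP[s0 s1].
  have [s2|s2] := leP (2 * s) 1.
    apply/is_linkP => i j x y ij /=; rewrite /g /c1 /c2.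
    have -> : Num.max 0 (2 * s - 1) = 0 by apply/max_idPl; rewrite subr_le0.
    rewrite !scale0r !addr0 min_r//.
    by apply: (is_linkP _).1 => //; apply: Hl; rewrite in_itv/= mulr_ge0.
  apply/is_linkP => i j x y ij /=; rewrite /g /c1 /c2.
  rewrite min_l ?(ltW s2)// max_r ?subr_ge0 ?(ltW s2)// !HK /D.
  apply: KK'; last by rewrite (inj_eq perm_inj).
  by rewrite subr_ge0 (ltW s2)/= lerBlDr -[1 + 1]/(2 : R) ler_piMr.
- apply: reparametrization_trans H0.
  apply: reparametrization_ext => i t; rewrite /= /g /c1 /c2 mulr0 min_r// max_l ?sub0r ?lerN10//.
  by rewrite scale0r addr0.
- exists sg, p; split=> // i t; rewrite /= /g /c1 /c2 mulr1.
  rewrite min_l ?ler1n// max_r; last by rewrite subr_ge0 ler1n.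
  by rewrite -[2]/(1 + 1) addrK scale1r HK /D addrC subrK.
Qed.

End link_homotopy_class.

(** * Fractional parts and periodic functions *)

Section fractional_part.
Variable R : realType.
Implicit Types (s t : R).

Definition fpart t : R := t - (Num.floor t)%:~R.

Lemma fpart_ge0 t : 0 <= fpart t.
Proof. by rewrite subr_ge0 floor_le_tmp. Qed.

Lemma fpart_lt1 t : fpart t < 1.
Proof. by rewrite ltrBlDl -[X in _ + X]/(1%:~R) -intrD floorD1_gt. Qed.

Lemma fpart01 t : fpart t \in `[0, 1].
Proof. by rewrite in_itv/= fpart_ge0 ltW// fpart_lt1. Qed.

Lemma fpartK t : (Num.floor t)%:~R + fpart t = t.
Proof. by rewrite addrC subrK. Qed.

Lemma fpartD1 t : fpart (t + 1) = fpart t.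
Proof. by rewrite /fpart floorDrz ?rpred1// floor1 intrD opprD addrACA subrr addr0. Qed.

Lemma periodic_fpart (V : zmodType) (f : R -> V) t :
  periodic f 1 -> f (fpart t) = f t.
Proof.
move=> fp; rewrite /fpart; case: (Num.floor t) => m.
  by rewrite -[in RHS](subrK ((Posz m)%:~R) t) (periodicn fp m).
by rewrite NegzE mulrNz opprK; exact: (periodicn fp m.+1 t).
Qed.

End fractional_part.

(** * Thick representatives of a link-homotopy class *)

Section rescaling.
Variables (R : realType) (n : nat).
Implicit Types (K L : closed_curve R n).

Lemma scaled_continuous (a : R) K i : continuous (fun t => a *: K i t).
Proof. by move=> t; apply: cvgZr; exact: component_continuous. Qed.

Lemma scaled_periodic (a : R) K i : periodic (fun t => a *: K i t) 1.
Proof. by move=> t; rewrite component_periodic. Qed.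

Definition scaled (a : R) K : closed_curve R n :=
  ClosedCurve (@scaled_continuous a K) (@scaled_periodic a K).

Lemma link_class_scaled (a : R) L : is_link L -> 1 <= a ->
  link_homotopy_class L (scaled a L).
Proof.
move=> lL a1; apply: (link_class_straight_line (link_class_refl lL)) => s /andP[s0 s1].
move=> i j x y ij /=.
have E (u : 'rV[R]_3) : u + s *: (a *: u - u) = (1 + s * (a - 1)) *: u.
  by rewrite scalerDl scale1r -scalerA scalerBl scale1r.
rewrite !E => /scalerI; rewrite gt_eqF ?ltr_wpDr ?mulr_ge0 ?subr_ge0// => /(_ isT).
exact: ((is_linkP _).1 lL).
Qed.

(** The distance between two disjoint components is attained, since both are
   images of the compact interval [[0, 1]]. *)
Lemma components_gap L (i j : 'I_n) : is_link L -> i != j ->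
  exists2 d : R, 0 < d & forall s t, d <= enorm (L i s - L j t).
Proof.
move=> lL ij; pose A := `[0%R, 1%R]%classic `*` `[0%R, 1%R]%classic : set (R * R).
pose F (p : R * R) := enorm (L i p.1 - L j p.2).
have A0 : A !=set0 by exists (0, 0); split; rewrite /= in_itv/= lexx ler01.
have cA : compact A by apply: compact_setX; exact: segment_compact.
have cF : {within A, continuous F}.
  apply: continuous_subspaceT => p.
  apply: (@continuous_comp _ _ _ (fun p : R * R => L i p.1 - L j p.2) (@enorm R) p);
    last exact: enorm_continuous.
  apply: cvgB.
    by apply: (@continuous_comp _ _ _ fst (L i)); [exact: cvg_fst|exact: component_continuous].
  by apply: (@continuous_comp _ _ _ snd (L j)); [exact: cvg_snd|exact: component_continuous].
have [[a b] _ ab] := compact_EVT_min A0 cA cF.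
exists (F (a, b)) => [|s t].
  rewrite lt_neqAle enorm_ge0 andbT eq_sym; apply/eqP => /enorm_eq0/eqP.
  by rewrite subr_eq0 => /eqP; exact: ((is_linkP _).1 lL).
rewrite -(periodic_fpart s (@component_periodic _ _ L i)).
rewrite -(periodic_fpart t (@component_periodic _ _ L j)).
by apply: (ab (fpart s, fpart t)); rewrite inE; split => /=; exact: fpart01.
Qed.

(** A link has positive thickness, and expanding it from the origin multiplies the
   thickness without creating collisions. *)
Lemma link_class_has_thick L : is_link L ->
  exists2 K, link_homotopy_class L K & (1 <= link_thickness K)%E.
Proof.
move=> lL.
have /choice[d dP] (p : 'I_n * 'I_n) : exists d : R, 0 < d /\
    (p.1 != p.2 -> forall s t, d <= enorm (L p.1 s - L p.2 t)).
  have [_|ne] := eqVneq p.1 p.2; first by exists 1.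
  by have [d d0 dL] := components_gap lL ne; exists d.
have d0 p : 0 < d p by have [] := dP p.
have S0 : 0 <= \sum_p (d p)^-1 by apply: sumr_ge0 => p _; rewrite invr_ge0 ltW.
(* A sum of inverses bounds them all, like a maximum, but needs no minimum of
   the gaps over the possibly empty set of pairs. *)
pose a := 1 + \sum_p (d p)^-1.
exists (scaled a L); first by apply: link_class_scaled => //; rewrite lerDl.
apply/thickness_ge1P => i j s t ij /=.
rewrite -scalerBr enormZ ger0_norm ?addr_ge0//.
apply: (@le_trans _ _ ((d (i, j))^-1 * d (i, j))).
  by rewrite mulVf// gt_eqF.
apply: ler_pM; rewrite ?invr_ge0 ?(ltW (d0 _))//.
  rewrite /a (bigD1 (i, j))//= addrCA lerDl addr_ge0//.
  by apply: sumr_ge0 => p _; rewrite invr_ge0 ltW.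
by have [_] := dP (i, j); exact.
Qed.

End rescaling.

(** * Length *)

Section length.
Variables (R : realType) (n : nat).
Implicit Types (K L : closed_curve R n) (f g : R -> 'rV[R]_3).

Lemma polygon_length_nil f a : polygon_length f a [::] = 0.
Proof. by rewrite /polygon_length big_nil. Qed.

Lemma polygon_length_cons f a t s :
  polygon_length f a (t :: s) = enorm (f a - f t) + polygon_length f t s.
Proof. by rewrite /polygon_length /= big_cons eucl_distE. Qed.

Lemma polygon_length_ge0 f a s : 0 <= polygon_length f a s.
Proof.
elim: s a => [|t s IH] a; first by rewrite polygon_length_nil.
by rewrite polygon_length_cons addr_ge0 ?enorm_ge0.
Qed.

Lemma polygon_length_map f g (T : R -> R) a s :
  (forall x y, enorm (g x - g y) <= enorm (f (T x) - f (T y))) ->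
  polygon_length g a s <= polygon_length f (T a) (map T s).
Proof.
move=> gf; elim: s a => [|t s IH] a; first by rewrite !polygon_length_nil.
by rewrite /= !polygon_length_cons lerD.
Qed.

Lemma polygon_le_curve_length K (a : 'I_n -> R) (s : 'I_n -> seq R) :
  (forall i, itv_partition (a i) (a i + 1) (s i)) ->
  ((\sum_i polygon_length (K i) (a i) (s i))%:E <= curve_length K)%E.
Proof. by move=> as_; apply: ereal_sup_ubound; exists a, s. Qed.

Lemma curve_length_leP K (c : \bar R) :
  (forall a s, (forall i, itv_partition (a i) (a i + 1) (s i)) ->
     ((\sum_i polygon_length (K i) (a i) (s i))%:E <= c)%E) ->
  (curve_length K <= c)%E.
Proof. by move=> Kc; apply/ge_ereal_sup => x [a [s [as_ ->]]]; exact: Kc. Qed.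

Lemma itv_partition_unit (a : R) : itv_partition a (a + 1) [:: a + 1].
Proof. by apply: itv_partition1; rewrite ltrDl. Qed.

Lemma curve_length_ge0 K : (0 <= curve_length K)%E.
Proof.
have := @polygon_le_curve_length K (fun=> 0) (fun=> [:: 0 + 1])
  (fun=> itv_partition_unit 0).
by apply: le_trans; rewrite lee_fin sumr_ge0// => i _; exact: polygon_length_ge0.
Qed.

Lemma itv_partition_map (T : R -> R) (a b : R) s :
  {homo T : x y / x < y} -> itv_partition a b s ->
  itv_partition (T a) (T b) (map T s).
Proof.
move=> Tm [as_ /eqP sb]; split; first exact: homo_path as_.
by rewrite last_map sb.
Qed.

(** Vertices of a polygon inscribed in [K'] are moved by [T] to vertices of a
   polygon inscribed in [K], so reparametrizing by an increasing [T] or moving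
   the components rigidly does not increase the length. *)
Lemma curve_length_le_map K K' (T : 'I_n -> R -> R) :
  (forall i, {homo T i : x y / x < y}) ->
  (forall i x, T i (x + 1) = T i x + 1) ->
  (forall i x y, enorm (K' i x - K' i y) <= enorm (K i (T i x) - K i (T i y))) ->
  (curve_length K' <= curve_length K)%E.
Proof.
move=> Tm T1 K'K; apply: curve_length_leP => a s as_.
have Tas i : itv_partition (T i (a i)) (T i (a i) + 1) (map (T i) (s i)).
  by rewrite -T1; exact: itv_partition_map.
apply: le_trans (polygon_le_curve_length K Tas); rewrite lee_fin.
by apply: ler_sum => i _; exact: polygon_length_map.
Qed.

(** The other components are given the degenerate polygon with one vertex. *)
Lemma polygon_le_length K i s (c : R) : (curve_length K <= c%:E)%E ->
  itv_partition 0 1 s -> polygon_length (K i) 0 s <= c.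
Proof.
move=> Kc s01; rewrite -lee_fin; apply: le_trans Kc.
pose p j := if j == i then s else [:: 0 + 1 : R].
have pP j : itv_partition 0 (0 + 1) (p j).
  by rewrite /p; case: eqP => _; [rewrite add0r|exact: itv_partition_unit].
apply: le_trans (polygon_le_curve_length K pP); rewrite lee_fin (bigD1 i)//=.
by rewrite /p eqxx lerDl sumr_ge0// => j _; exact: polygon_length_ge0.
Qed.

End length.

(** * Lipschitz representatives *)

Section arc_length.
Variables (R : realType) (f : R -> 'rV[R]_3) (M : R).
Hypotheses (fc : continuous f) (fp : periodic f 1).
Hypothesis fM : forall s, itv_partition 0 1 s -> polygon_length f 0 s <= M.

Let coord k t := f t 0 k.

Lemma variation_le_polygon_length k a b s :
  variation a b (coord k) s <= polygon_length f a s.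
Proof.
elim: s a => [|t s IH] a; first by rewrite /variation big_nil polygon_length_nil.
rewrite polygon_length_cons /variation /= big_nat_recl//=; apply: lerD.
  have := coord_le_enorm (f t - f a) k.
  by rewrite !mxE enormB.
exact: IH.
Qed.

Lemma component_coord_continuous k : continuous (coord k).
Proof. by move=> t; apply: (@continuous_comp _ _ _ f (fun u : 'rV[R]_3 => u 0 k));
  [exact: fc|exact: coord_continuous]. Qed.

Lemma coord_bounded_variation k : bounded_variation 0 1 (coord k).
Proof.
exists M => _ [s s01 <-]; apply: le_trans (fM s01).
exact: variation_le_polygon_length.
Qed.

Let tv k t := fine (total_variation 0 t (coord k)).

Lemma tv_fin k t : 0 <= t <= 1 -> total_variation 0 t (coord k) \is a fin_num.
Proof.
move=> /andP[t0 t1]; apply/bounded_variationP => //.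
exact: (bounded_variationl t0 t1 (coord_bounded_variation k)).
Qed.

Lemma tv_increment k s t : 0 <= s -> s <= t -> t <= 1 ->
  `|coord k t - coord k s| <= tv k t - tv k s.
Proof.
move=> s0 st t1; have t01 : 0 <= t <= 1 by rewrite (le_trans s0).
have s01 : 0 <= s <= 1 by rewrite s0 (le_trans st).
have := tv_fin k t01; have := tv_fin k s01.
have := total_variation_ge (coord k) st.
rewrite /tv (total_variationD _ s0 st).
case: (total_variation 0 s _) => // a; case: (total_variation s t _) => // b.
by rewrite lee_fin/= addrAC subrr add0r.
Qed.

Lemma tv_unit_le k : tv k 1 <= M.
Proof.
rewrite -lee_fin fineK ?tv_fin ?lexx ?ler01//.
apply: ge_ereal_sup => _ [_ [s s01 <-] <-]; rewrite lee_fin.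
by apply: le_trans (fM s01); exact: variation_le_polygon_length.
Qed.

Lemma tv_continuous k : {within `[0, 1], continuous (tv k)}.
Proof.
apply: total_variation_continuous => //; last exact: coord_bounded_variation.
by apply: continuous_subspaceT; exact: component_coord_continuous.
Qed.

Lemma tv0 k : tv k 0 = 0.
Proof. by rewrite /tv total_variationxx. Qed.

Let c := \sum_k tv k 1 + 1.
Let unit_arc t := (\sum_k tv k t + t) / c.

Lemma arc_length_ge1 : 1 <= c.
Proof.
rewrite lerDr sumr_ge0// => k _.
have := le_trans (normr_ge0 _) (tv_increment k (lexx 0) ler01 (lexx 1)).
by rewrite tv0 subr0.
Qed.

Lemma arc_length_gt0 : 0 < c.
Proof. exact: lt_le_trans arc_length_ge1. Qed.

Lemma arc_length_le : c <= 3 * M + 1.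
Proof.
rewrite lerD2r; have -> : 3 * M = \sum_(k < 3) M.
  by rewrite sumr_const card_ord mulr_natl.
by apply: ler_sum => k _; exact: tv_unit_le.
Qed.

(** The term [t] in [unit_arc] makes it strictly increasing even where [f] is
   constant, so that it can be inverted; dividing by [c] makes it map [[0, 1]]
   onto itself. *)
Lemma unit_arc_increment s t : 0 <= s -> s <= t -> t <= 1 ->
  enorm (f s - f t) + (t - s) <= c * (unit_arc t - unit_arc s).
Proof.
move=> s0 st t1; rewrite /unit_arc -mulrBl mulrCA mulfV ?gt_eqF ?arc_length_gt0// mulr1.
rewrite opprD addrACA lerD2r -sumrB enormB.
apply: le_trans (enorm_le_sum _) _.
by apply: ler_sum => k _; rewrite !mxE; exact: tv_increment.
Qed.

Lemma unit_arc0 : unit_arc 0 = 0.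
Proof. by rewrite /unit_arc addr0 big1 ?mul0r// => k _; exact: tv0. Qed.

Lemma unit_arc1 : unit_arc 1 = 1.
Proof. by rewrite /unit_arc mulfV// gt_eqF// arc_length_gt0. Qed.

Lemma unit_arc_continuous : {within `[0, 1], continuous unit_arc}.
Proof.
move=> t; apply: cvgMl; apply: cvgD; last first.
  by apply: continuous_subspaceT => ?; exact: cvg_id.
by apply: cvg_big => [|k _]; [exact: add_continuous|exact: tv_continuous].
Qed.

Let arc t := (Num.floor t)%:~R + unit_arc (fpart t).

(** When [s] and [t] have different integer parts, the polygon from [s] to [t]
   can be broken at an integer, where [f] takes the value [f 0 = f 1]; full turns
   in between count once on the left and [c >= 1] times on the right. *)
Lemma arc_increment s t : s < t -> enorm (f s - f t) + (t - s) <= c * (arc t - arc s).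
Proof.
move=> st; have /andP[fs0 fs1] : 0 <= fpart s <= 1 := fpart01 s.
have /andP[ft0 ft1] : 0 <= fpart t <= 1 := fpart01 t.
rewrite -(periodic_fpart s fp) -(periodic_fpart t fp) /arc.
have -> : t - s = (Num.floor t)%:~R + fpart t - ((Num.floor s)%:~R + fpart s).
  by rewrite !fpartK.
have : Num.floor s <= Num.floor t by exact/le_floor/ltW.
rewrite le_eqVlt => /predU1P[fst|fst].
  have E (x y z : R) : z + x - (z + y) = x - y.
    by rewrite opprD addrACA subrr add0r.
  by rewrite -fst !E unit_arc_increment// /fpart -fst lerD2r ltW.
have fst1 : (Num.floor s)%:~R + 1 <= (Num.floor t)%:~R :> R.
  by rewrite -[X in _ + X]/(1%:~R) -intrD ler_int lezD1.
have := unit_arc_increment fs0 fs1 (lexx 1).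
have := unit_arc_increment (lexx 0) ft0 ft1.
have -> : f 1 = f 0 by rewrite -[1]add0r fp.
have := enorm_triangle (f (fpart s)) (f 0) (f (fpart t)).
have := arc_length_ge1; rewrite unit_arc0 unit_arc1.
move: (enorm _) (enorm _) (enorm _) fst1 => x y z.
move: ((Num.floor s)%:~R) ((Num.floor t)%:~R) => a b; nra.
Qed.

(** A reparametrization with the continuity of arc length and the strict
   monotonicity of the parameter: it is a sum of the variations of the three
   coordinates, which bounds the Euclidean arc length from above and is at most
   three times as long, and of the parameter itself. *)
Lemma exists_arc_length : exists W : R -> R,
  [/\ forall s t, s < t -> W s < W t,
      forall t, W (t + 1) = W t + 1,
      forall y, exists t, W t = y &
      forall s t, s <= t -> enorm (f s - f t) <= (3 * M + 1) * (W t - W s)].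
Proof.
have arc_lt s t : s < t -> arc s < arc t.
  move=> st; rewrite -subr_gt0 -(pmulr_rgt0 _ arc_length_gt0).
  by rewrite (lt_le_trans _ (arc_increment st))// ltr_wpDl ?enorm_ge0 ?subr_gt0.
exists arc; split=> //.
- move=> t; rewrite /arc fpartD1 floorDrz ?rpred1// floor1 intrD; ring.
- move=> y; have y01 : Num.min (unit_arc 0) (unit_arc 1) <= fpart y <= Num.max (unit_arc 0) (unit_arc 1).
    by rewrite unit_arc0 unit_arc1 min_l// max_r//; exact: fpart01.
  have [t] := IVT ler01 unit_arc_continuous y01.
  rewrite in_itv/= => /andP[t0 t1] wt.
  have {}t1 : t < 1.
    rewrite lt_neqAle t1 andbT; apply: contra_eq_neq wt => ->.
    by rewrite unit_arc1 gt_eqF// fpart_lt1.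
  exists ((Num.floor y)%:~R + t).
  rewrite /arc /fpart floorDzr ?inE ?intr_int// intrKfloor.
  have -> : Num.floor t = 0 by apply: floor_def; rewrite t0 add0r.
  by rewrite addr0 addrAC subrr add0r wt fpartK.
- move=> s t; rewrite le_eqVlt => /predU1P[->|st].
    by rewrite !subrr enorm0 mulr0.
  apply: (@le_trans _ _ (c * (arc t - arc s))).
    by apply: le_trans (arc_increment st); rewrite lerDl subr_ge0 ltW.
  by rewrite ler_wpM2r ?arc_length_le// subr_ge0 ltW// arc_lt.
Qed.

End arc_length.

Section lipschitz_representative.
Variable R : realType.

(** A monotone function has only jump discontinuities, and a jump would leave out
   values. *)
Lemma increasing_surjective_continuous (W : R -> R) :
  {homo W : s t / s < t} -> (forall y, exists t, W t = y) -> continuous W.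
Proof.
move=> Wlt Wsurj t; apply/cvgrPdist_lt => e e0.
have mono := le_mono Wlt.
have [a Wa] := Wsurj (W t - e); have [b Wb] := Wsurj (W t + e).
have at_ : a < t by rewrite -(leW_mono mono) Wa ltrBlDr ltrDl.
have tb : t < b by rewrite -(leW_mono mono) Wb ltrDl.
near=> s; rewrite ltr_distlC -Wa -Wb !(leW_mono mono).
by apply/andP; split; near: s; [exact: lt_nbhsr|exact: lt_nbhsl].
Unshelve. all: by end_near. Qed.

Variable n : nat.
Implicit Types (K L : closed_curve R n).

Definition lipschitz_curve (C : R) K :=
  forall i s t, enorm (K i s - K i t) <= C * `|s - t|.

(** [K'] is [K] composed with the inverse [T] of the modified arc length [W]. *)
Lemma lipschitz_reparametrization K (M : R) : (curve_length K <= M%:E)%E ->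
  exists K', [/\ reparametrization K K', lipschitz_curve (3 * M + 1) K',
    (curve_length K' <= curve_length K)%E &
    forall i t, range (K i) (K' i t)].
Proof.
move=> KM.
have /choice[W WP] (i : 'I_n) : exists W : R -> R,
  [/\ forall s t, s < t -> W s < W t,
      forall t, W (t + 1) = W t + 1,
      forall y, exists t, W t = y &
      forall s t, s <= t ->
        enorm (K i s - K i t) <= (3 * M + 1) * (W t - W s)].
  apply: exists_arc_length.
  - exact: component_continuous.
  - exact: component_periodic.
  - by move=> s; exact: polygon_le_length.
have Wlt i : {homo W i : s t / s < t} by have [] := WP i.
have W1 i t : W i (t + 1) = W i t + 1 by have [] := WP i.
have Wle i s t : s <= t ->
    enorm (K i s - K i t) <= (3 * M + 1) * (W i t - W i s).
  by have [_ _ _] := WP i; exact.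
have /choice[T' T'K] (p : 'I_n * R) : exists t, W p.1 t = p.2.
  by have [_ _ + _] := WP p.1; exact.
pose T i y := T' (i, y).
have TK i y : W i (T i y) = y by exact: T'K (i, y).
have mono i := le_mono (Wlt i).
have Winj i : injective (W i) by move=> x y /eqP; rewrite eq_le !(mono i) -eq_le => /eqP.
have WK i t : T i (W i t) = t by apply: (Winj i); rewrite TK.
have Tlt i : {homo T i : x y / x < y}.
  by move=> x y xy; rewrite -(leW_mono (mono i) (T i x)) !TK.
have T1 i y : T i (y + 1) = T i y + 1.
  by apply: (Winj i); rewrite W1 !TK.
pose k i y := K i (T i y).
have kL i x y : enorm (k i x - k i y) <= (3 * M + 1) * `|x - y|.
  wlog xy : x y / x <= y => [H|].
    by have [/H//|/ltW /H] := leP x y; rewrite enormB distrC.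
  rewrite distrC ger0_norm ?subr_ge0//.
  have := Wle i (T i x) (T i y); rewrite !TK; apply.
  by rewrite -(mono i) !TK.
have kc i : continuous (k i) by exact: lipschitz_continuous (kL i).
have kp i : periodic (k i) 1.
  by move=> t; rewrite /k T1 component_periodic.
exists (ClosedCurve kc kp); split=> //=.
- exists 1%g, W; split=> //.
    move=> i; apply: increasing_surjective_continuous => // y.
    by exists (T i y).
  by move=> i t; rewrite perm1 /= /k WK.
- exact: (@curve_length_le_map _ _ K _ T).
- by move=> i t; exists (T i t).
Qed.

Lemma thickness_range K K' : (forall i t, range (K i) (K' i t)) ->
  (1 <= link_thickness K)%E -> (1 <= link_thickness K')%E.
Proof.
move=> KK' /thickness_ge1P K1; apply/thickness_ge1P => i j s t ij.
by have [x _ <-] := KK' i s; have [y _ <-] := KK' j t; exact: K1.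
Qed.

End lipschitz_representative.

(** * Gathering the components *)

Section gathering.
Variables (R : realType) (n : nat).
Implicit Types (K L : closed_curve R n) (v w : 'I_n -> 'rV[R]_3).

Lemma translate_continuous v K i : continuous (fun t => K i t + v i).
Proof. by move=> t; apply: cvgD; [exact: component_continuous|exact: cvg_cst]. Qed.

Lemma translate_periodic v K i : periodic (fun t => K i t + v i) 1.
Proof. by move=> t; rewrite component_periodic. Qed.

Definition translate v K : closed_curve R n :=
  ClosedCurve (@translate_continuous v K) (@translate_periodic v K).

Lemma curve_length_translate v K :
  (curve_length (translate v K) <= curve_length K)%E.
Proof.
apply: (@curve_length_le_map _ _ K _ (fun=> id)) => [i x y //|//|i x y /=].
by rewrite opprD addrACA subrr addr0.
Qed.

Lemma lipschitz_translate C v K :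
  lipschitz_curve C K -> lipschitz_curve C (translate v K).
Proof.
by move=> KC i s t; rewrite /= opprD addrACA subrr addr0; exact: KC.
Qed.

Lemma link_class_translate L K v : link_homotopy_class L K ->
  (forall s, 0 <= s <= 1 ->
     (1 <= link_thickness (translate (fun i => s *: v i) K))%E) ->
  link_homotopy_class L (translate v K).
Proof.
move=> LK Kv; apply: (link_class_straight_line LK) => s s01 i j x y ij /=.
rewrite [K i x + v i]addrC [K j y + v j]addrC !addrK => E.
have /thickness_ge1P/(_ i j x y ij) := Kv s s01.
by rewrite /= E subrr enorm0 ler10.
Qed.

(** The points [c j], for [j] in [T], are carried along by [u] until one of them
   enters the ball of radius [rho]. The infimum of the entrance times may be
   passed a little, as long as this moves no point by more than [1]; so it does
   not matter whether it is attained. If a point lies in the ball from the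
   start, there is no motion and nothing to know about the way. *)
Lemma first_entrance (T : {set 'I_n}) (c : 'I_n -> 'rV[R]_3) (u : 'rV[R]_3)
    (rho : R) :
  (exists2 j, j \in T & enorm (c j + u) <= rho) ->
  exists s, [/\ 0 <= s <= 1,
    exists2 j, j \in T & enorm (c j + s *: u) <= rho &
    s = 0 \/
    forall t j, 0 <= t <= s -> j \in T -> rho - 1 <= enorm (c j + t *: u)].
Proof.
move=> Tu.
pose A := [set s : R | 0 <= s <= 1 /\
  exists2 j, j \in T & enorm (c j + s *: u) <= rho].
have A1 : A 1.
  by split; [rewrite ler01 lexx|have [j jT ?] := Tu; exists j; rewrite ?scale1r].
have Alb : lbound A 0 by move=> s [/andP[]].
have Ai : has_inf A by split; [exists 1|exists 0].
pose d := (enorm u + 1)^-1.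
have u1 : 0 < enorm u + 1 by rewrite ltr_wpDl ?enorm_ge0.
have d0 : 0 < d by rewrite invr_gt0.
have [A0|nA0] := pselect (A 0).
  by exists 0; split; [rewrite lexx ler01|case: A0|left].
have [s [s01 sT] sd] := inf_adherent d0 Ai.
exists s; split => //; right => t j /andP[t0 ts] jT.
pose t' := Num.max 0 (t - d).
have nAt' : ~ A t'.
  rewrite /t'; have [_|td] := leP 0 (t - d); last by [].
  move=> /(ge_inf (ex_intro _ 0 Alb)); rewrite leNgt => /negP; apply.
  by rewrite ltrBlDr (le_lt_trans ts).
have t't : t - t' <= d /\ 0 <= t - t'.
  rewrite /t'; have [_|td] := leP 0 (t - d); rewrite ?subr0.
    by rewrite opprB addrC subrK lexx ltW.
  by split=> //; rewrite ltW// -subr_lt0.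
have rt' : rho < enorm (c j + t' *: u).
  rewrite ltNge; apply/negP => le; apply: nAt'; split; last by exists j.
  rewrite le_max lexx/= ge_max ler01/= (le_trans _ (le_trans ts _))//.
    by rewrite gerBl ltW.
  by case/andP: s01.
have := enorm_lerB (c j + t' *: u) (c j + t *: u).
have -> : c j + t' *: u - (c j + t *: u) = - ((t - t') *: u).
  by rewrite opprD addrACA subrr add0r -scalerBl -scaleNr opprB.
rewrite enormN enormZ ger0_norm; last by case: t't.
have : (t - t') * enorm u <= 1.
  apply: (@le_trans _ _ (d * (enorm u + 1))); last by rewrite mulVf// gt_eqF.
  by apply: ler_pM; rewrite ?enorm_ge0 ?lerDl//; case: t't.
lra.
Qed.

(** A split link could drift apart without getting longer, so compactness has to
   be enforced by bringing far away components back. By induction on the number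
   of components outside [S], these are translated all together, along the
   segment that brings one of them to the origin, until one of them comes within
   [2 * r + 2] of the ball that contains the base points of [S]; that one joins
   [S]. Up to then the base points of the moving components are at distance at
   least [2 * r + 1] from those of [S], which leaves a distance [1] between the
   components, whose points are within [r] of their base points; and the moving
   components keep their mutual distances. *)
Lemma gather L (r : R) (S : {set 'I_n}) K : 0 <= r ->
  link_homotopy_class L K -> (1 <= link_thickness K)%E ->
  (forall i t, enorm (K i t - K i 0) <= r) ->
  (forall i, i \in S -> enorm (K i 0) <= #|S|%:R * (2 * r + 2)) ->
  exists v, [/\ link_homotopy_class L (translate v K),
    (1 <= link_thickness (translate v K))%E &
    forall i, enorm (K i 0 + v i) <= n%:R * (2 * r + 2)].
Proof.
move=> r0; pose D := 2 * r + 2; have D0 : 0 <= D by rewrite /D; lra.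
have [k kS] : exists k, #|~: S| = k by exists #|~: S|.
elim: k S K kS => [|k IH] S K kS LK Kthick Kr KS.
  exists (fun=> 0).
  have sc : forall s, (1 <= link_thickness (translate (fun=> s *: 0) K))%E.
    move=> s; apply: thickness_range Kthick => i t.
    by exists t => //=; rewrite scaler0 addr0.
  split.
  - exact: link_class_translate.
  - by have := sc 1; rewrite scale1r.
  - move=> i; rewrite addr0; have iS : i \in S.
      by move/eqP: kS; rewrite cards_eq0 => /eqP/setP/(_ i); rewrite !inE => /negbFE.
    apply: le_trans (KS i iS) _; rewrite ler_wpM2r// ler_nat.
    by rewrite -[leqRHS]card_ord max_card.
have [j0 j0S] : exists j, j \in ~: S by apply/set0Pn; rewrite -cards_eq0 kS.
pose rho := (#|S|%:R + 1) * D.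
have [|s [s01 [j jS jrho] sfirst]] := @first_entrance (~: S) (fun i => K i 0) (- K j0 0) rho.
  by exists j0 => //; rewrite subrr enorm0 mulr_ge0// addr_ge0.
pose v i := if i \in S then 0 else s *: - K j0 0.
have vthick t : 0 <= t <= 1 ->
    (1 <= link_thickness (translate (fun i => t *: v i) K))%E.
  move=> t01; have st : 0 <= t * s <= s.
    case/andP: t01 => t0 t1; case/andP: s01 => s0 _.
    by rewrite mulr_ge0//= ler_piMl.
  apply/thickness_ge1P.
  have main i i' x y : i \in S -> i' \notin S ->
      1 <= enorm (translate (fun i => t *: v i) K i x - translate (fun i => t *: v i) K i' y).
    move=> iS i'S; rewrite /= /v iS (negbTE i'S) scaler0 addr0 scalerA.
    case: sfirst => [->|/(_ (t * s) i' st)].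
      rewrite mulr0 scale0r addr0; apply: (thickness_ge1P _).1 => //.
      by apply: contraNneq i'S => <-.
    rewrite inE i'S => /(_ isT); set w := _ *: _.
    have := Kr i x; have := KS i iS; have := Kr i' y.
    rewrite /rho -/D => h1 h2 h3 h4.
    rewrite enormB.
    have := enorm_lerB (K i' y + w) (K i x).
    have := enorm_triangle (K i' 0 + w) (K i' y + w) 0.
    have := enorm_triangle (K i x) (K i 0) 0.
    rewrite !subr0 (_ : K i' 0 + w - (K i' y + w) = - (K i' y - K i' 0)); last first.
      by rewrite opprD addrACA subrr addr0 opprB.
    rewrite enormN mulrDl mul1r in h4 *.
    rewrite /D in h2 h4 *; lra.
  move=> i i' x y ii'; have [iS|iS] := boolP (i \in S);
    have [i'S|i'S] := boolP (i' \in S).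
  - rewrite /= /v iS i'S scaler0 !addr0; exact: (thickness_ge1P _).1.
  - exact: main.
  - by rewrite enormB; exact: main.
  - rewrite /= /v (negbTE iS) (negbTE i'S) opprD addrACA subrr addr0.
    exact: (thickness_ge1P _).1.
have LK' : link_homotopy_class L (translate v K) by exact: link_class_translate.
have K'thick : (1 <= link_thickness (translate v K))%E.
  have : (1 <= link_thickness (translate (fun i => 1 *: v i) K))%E.
    by apply: vthick; rewrite ler01 lexx.
  by apply: thickness_range => i t; exists t => //=; rewrite scale1r.
have jS' : j \notin S by rewrite inE in jS.
have cS : #|j |: S| = #|S|.+1 by rewrite cardsU1 jS'.
have [|||||w [Lw wthick wn]] := IH (j |: S) (translate v K).
- have -> : ~: (j |: S) = (~: S) :\ j by apply/setP => i; rewrite !inE negb_or.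
  by move: kS; rewrite (cardsD1 j) jS => -[].
- exact: LK'.
- exact: K'thick.
- by move=> i t /=; rewrite opprD addrACA subrr addr0.
- move=> i; rewrite cS -natr1 -/D -/rho; rewrite !inE /= /v => /predU1P[->|iS].
    by rewrite (negbTE jS').
  rewrite iS addr0; apply: le_trans (KS i iS) _.
  by rewrite /rho -/D ler_wpM2r// lerDl.
exists (fun i => v i + w i).
have e i t : translate w (translate v K) i t = translate (fun i => v i + w i) K i t.
  by rewrite /= addrA.
split.
- apply: (link_class_reparametrization Lw); exact: reparametrization_ext.
- by apply: thickness_range wthick => i t; exists t => //; rewrite e.
- by move=> i; rewrite addrA; exact: wn.
Qed.

End gathering.

(** * Pointwise limits *)

(** A proper filter finer than the image of [U] cannot contain a set whose
   preimage has its complement in [U]. *)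
Lemma ultra_fmap (S T : Type) (U : set_system S) (f : S -> T) :
  UltraFilter U -> UltraFilter (f @ U).
Proof.
move=> UU; apply: Build_UltraFilter => G GG fUG; apply/seteqP; split=> [A GA|//].
have [//|UnA] := in_ultra_setVsetC (f @^-1` A) UU.
have GnA : G (~` A) by apply: fUG.
by have [x []] := filter_ex (filterI GA GnA).
Qed.

Section pointwise_limit.
Variables (R : realType) (n : nat).
Implicit Types (K L : closed_curve R n).
Variables (u : nat -> closed_curve R n) (C B : R).
Hypotheses (uC : forall m, lipschitz_curve C (u m))
  (uthick : forall m, (1 <= link_thickness (u m))%E).
Variable U : set_system nat.
Hypothesis UU : UltraFilter U.

Lemma bounded_ultra_cvg (v : nat -> 'rV[R]_3) :
  (forall m, enorm (v m) <= B) -> exists l : 'rV[R]_3, v m @[m --> U] --> l.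
Proof.
move=> vB; pose A := [set w : 'rV[R]_3 | forall i, `[- B, B]%classic (w 0 i)].
have cA : compact A.
  by apply: (@rV_compact _ _ (fun=> `[- B, B]%classic)) => _; exact: segment_compact.
move: cA; rewrite compact_ultra => /(_ (v @ U)) [||l [_ vl]].
- exact: ultra_fmap.
- apply: (@filterS _ U _ setT (v @^-1` A)) filterT => m _ i /=; rewrite in_itv/= -ler_norml.
  by apply: le_trans (vB m); exact: coord_le_enorm.
by exists l.
Qed.

Variable l : 'I_n -> R -> 'rV[R]_3.
Hypothesis ul : forall i t, u m i t @[m --> U] --> l i t.

Lemma enorm_cvg i j s t :
  enorm (u m i s - u m j t) @[m --> U] --> enorm (l i s - l j t).
Proof.
apply: (@cvg_comp _ _ _ (fun m => u m i s - u m j t) (@enorm R)).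
  by apply: cvgB; exact: ul.
exact: enorm_continuous.
Qed.

Lemma limit_lipschitz i s t : enorm (l i s - l i t) <= C * `|s - t|.
Proof.
apply: cvgr_to_le (@enorm_cvg i i s t) _.
by apply: filterS filterT => m _; exact: uC.
Qed.

Lemma limit_continuous i : continuous (l i).
Proof. exact: lipschitz_continuous (limit_lipschitz i). Qed.

Lemma limit_periodic i : periodic (l i) 1.
Proof.
move=> t; have := @ul i (t + 1).
under eq_fun do rewrite component_periodic.
by move=> h; apply: cvg_unique h (@ul i t).
Qed.

Definition limit_curve : closed_curve R n :=
  ClosedCurve (@limit_continuous) (@limit_periodic).

Lemma limit_thick : (1 <= link_thickness limit_curve)%E.
Proof.
apply/thickness_ge1P => i j s t ij /=.
apply: cvgr_to_ge (@enorm_cvg i j s t) _.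
by apply: filterS filterT => m _; exact: (thickness_ge1P _).1.
Qed.

(** The Lipschitz bound spreads pointwise convergence at a parameter to a
   neighbourhood of that parameter, hence, by compactness of [[0, 1]], to all
   parameters at once. *)
Lemma limit_uniform e : 0 < e ->
  \forall m \near U, forall i t, enorm (u m i t - l i t) < e.
Proof.
move=> e0; apply: filter_forall => i.
have : \forall m \near U, `[0%R, 1%R]%classic `<=` [set t | enorm (u m i t - l i t) < e].
  apply: (compact_near_coveringP _).1 => [|t _]; first exact: segment_compact.
  have e2 : 0 < e / 2 by rewrite divr_gt0.
  have d0 : 0 < (`|C| + 1)^-1 * (e / 4) by rewrite mulr_gt0 ?invr_gt0 ?ltr_wpDl ?divr_gt0.
  exists (ball t ((`|C| + 1)^-1 * (e / 4)),
          [set m | enorm (u m i t - l i t) < e / 2]).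
    split=> /=; first exact: nbhsx_ballx.
    have : (fun m => enorm (u m i t - l i t)) @ U --> enorm (l i t - l i t).
      apply: (@cvg_comp _ _ _ (fun m => u m i t - l i t) (@enorm R)).
        by apply: cvgB; [exact: ul|exact: cvg_cst].
      exact: enorm_continuous.
    rewrite subrr enorm0 => h.
    by apply: (h [set x | x < e / 2]); exact: lt_nbhsl.
  move=> [t' m] [/= tt' mt].
  have CC : C * `|t - t'| <= e / 4.
    apply: (@le_trans _ _ ((`|C| + 1) * `|t - t'|)).
      by rewrite ler_wpM2r// (le_trans (ler_norm _))// lerDl.
    by rewrite -ler_pdivlMl ?ltr_wpDl// ltW.
  have h1 := enorm_triangle (u m i t') (u m i t) (l i t').
  have h2 := enorm_triangle (u m i t) (l i t) (l i t').
  have := limit_lipschitz i t t'; have := uC m i t' t; rewrite (distrC t').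
  move: mt; rewrite /=; lra.
apply: filterS => m h t; have := h _ (fpart01 t).
by rewrite /= !periodic_fpart//; [exact: limit_periodic|exact: component_periodic].
Qed.

(** Once [u m] is within [1/2] of the limit, the segments from one to the other
   cannot make two components meet, since these are at distance at least [1] in
   [u m]. *)
Lemma limit_class L : (forall m, link_homotopy_class L (u m)) ->
  link_homotopy_class L limit_curve.
Proof.
move=> Lu; have h0 : 0 < 2^-1 :> R by rewrite invr_gt0.
have [m um] := filter_ex (limit_uniform h0).
apply: (link_class_straight_line (Lu m)) => s /andP[s0 s1] i j x y ij /= E.
have := (thickness_ge1P _).1 (uthick m) i j x y ij.
have -> : u m i x - u m j y =
    s *: (u m i x - l i x) - s *: (u m j y - l j y).
  transitivity (u m i x + s *: (l i x - u m i x)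
      - (u m j y + s *: (l j y - u m j y))
      + (s *: (u m i x - l i x) - s *: (u m j y - l j y))).
    by apply/rowP => k; rewrite !mxE; ring.
  by rewrite E subrr add0r.
have sm k z : enorm (s *: (u m k z - l k z)) < 2^-1.
  rewrite enormZ ger0_norm// (le_lt_trans _ (um k z))//.
  by rewrite ler_piMl ?enorm_ge0.
have := enormD (s *: (u m i x - l i x)) (- (s *: (u m j y - l j y))).
rewrite enormN; have := sm i x; have := sm j y; lra.
Qed.

Lemma polygon_length_cvg i a s :
  polygon_length (u m i) a s @[m --> U] --> polygon_length (l i) a s.
Proof.
elim: s a => [|t s IH] a.
  by under eq_fun do rewrite polygon_length_nil; rewrite polygon_length_nil; exact: cvg_cst.
under eq_fun do rewrite polygon_length_cons.
by rewrite polygon_length_cons; apply: cvgD; [exact: enorm_cvg|exact: IH].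
Qed.

(** Length is a supremum of functions of finitely many points of the curve,
   hence lower semicontinuous for pointwise convergence. *)
Lemma limit_length (c : R) :
  (forall e, 0 < e -> \forall m \near U, (curve_length (u m) <= (c + e)%:E)%E) ->
  (curve_length limit_curve <= c%:E)%E.
Proof.
move=> uc; apply: curve_length_leP => a s as_; rewrite lee_fin.
apply/ler_addgt0Pr => e e0.
have : \sum_i polygon_length (u m i) (a i) (s i) @[m --> U] -->
    \sum_i polygon_length (l i) (a i) (s i).
  by apply: cvg_big => [|i _]; [exact: add_continuous|exact: polygon_length_cvg].
move=> /cvgr_to_le; apply; apply: filterS (uc e e0) => m; rewrite -lee_fin; apply: le_trans.
exact: polygon_le_curve_length.
Qed.

End pointwise_limit.

(** * Existence of a minimizer *)

Section minimizer.
Variables (R : realType) (n : nat).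
Implicit Types (K L : closed_curve R n).

(** The bounds depend on [M] and [n] only, which is what compactness needs. The
   translation comes after the reparametrization because the diameter of the
   components is read off their Lipschitz constant. *)
Lemma normalized_representative L K (M : R) : 0 <= M ->
  link_homotopy_class L K -> (1 <= link_thickness K)%E ->
  (curve_length K <= M%:E)%E ->
  let C := 3 * M + 1 in
  exists K', [/\ link_homotopy_class L K', (1 <= link_thickness K')%E,
    (curve_length K' <= curve_length K)%E, lipschitz_curve C K' &
    forall i t, enorm (K' i t) <= n%:R * (2 * C + 2) + C].
Proof.
move=> M0 LK Kthick KM C; have C0 : 0 <= C by rewrite /C; lra.
have [K1 [KK1 K1C K1K K1r]] := lipschitz_reparametrization KM.
have LK1 := link_class_reparametrization LK KK1.
have K1thick := thickness_range K1r Kthick.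
have K1diam i t : enorm (K1 i t - K1 i 0) <= C.
  rewrite -(periodic_fpart t (@component_periodic _ _ K1 i)).
  apply: le_trans (K1C _ _ _) _.
  by rewrite subr0 ger0_norm ?fpart_ge0// ler_piMr// ltW// fpart_lt1.
have [|v [Lv vthick vn]] := gather (S := finset.set0) C0 LK1 K1thick K1diam.
  by move=> i; rewrite inE.
exists (translate v K1); split=> //.
- exact: le_trans (curve_length_translate _ _) K1K.
- exact: lipschitz_translate.
- move=> i t /=; rewrite (_ : K1 i t + v i = K1 i 0 + v i + (K1 i t - K1 i 0)).
    by apply: le_trans (enormD _ _) _; exact: lerD.
  by rewrite addrAC addrCA subrr addr0.
Qed.

End minimizer.

Theorem proposition6p7 (R : realType) (n : nat) (L : closed_curve R n)
    (hL : is_link L) :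
  exists L0 : closed_curve R n,
    [/\ link_homotopy_class L L0,
        (1 <= link_thickness L0)%E &
        forall K : closed_curve R n, link_homotopy_class L K ->
          (1 <= link_thickness K)%E ->
          (curve_length L0 <= curve_length K)%E].
Proof.
pose admissible := [set K | link_homotopy_class L K /\ (1 <= link_thickness K)%E].
pose ell := ereal_inf [set curve_length K | K in admissible].
have ell_le K : admissible K -> (ell <= curve_length K)%E.
  by move=> aK; apply: ereal_inf_lbound; exists K.
have [K0 LK0 K0thick] := link_class_has_thick hL.
have ell0 : (0 <= ell)%E.
  by apply/le_ereal_inf_tmp => _ [K _ <-]; exact: curve_length_ge0.
(* If all admissible curves have infinite length, any of them is a minimizer. *)
have [ellfin|ellinf] := boolP (ell \is a fin_num); last first.
  exists K0; split=> // K LK Kthick.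
  have -> : curve_length K = +oo%E; last exact: leey.
  apply/eqP; rewrite -leye_eq (le_trans _ (ell_le _ (conj LK Kthick)))//.
  by move: ell0 ellinf; case: (ell).
pose c := fine ell; have cE : ell = c%:E by rewrite /c fineK.
have c0 : 0 <= c by rewrite -lee_fin -cE.
pose C := 3 * (c + 1) + 1; pose B := n%:R * (2 * C + 2) + C.
have /choice[u uP] (m : nat) : exists K, [/\ admissible K,
    (curve_length K <= (c + m.+1%:R^-1)%:E)%E, lipschitz_curve C K &
    forall i t, enorm (K i t) <= B].
  have m0 : 0 < m.+1%:R^-1 :> R by rewrite invr_gt0 ltr0n.
  have [_ [K [LK Kthick] <-] Kc] := lb_ereal_inf_adherent m0 ellfin.
  have {}Kc : (curve_length K <= (c + m.+1%:R^-1)%:E)%E.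
    by rewrite EFinD -cE ltW.
  have [||K' [LK' K'thick K'K K'C K'B]] :=
    @normalized_representative _ _ L K (c + 1) _ LK Kthick.
  - by rewrite addr_ge0.
  - apply: le_trans Kc _; rewrite lee_fin lerD2l invf_le1 ?ltr0n//.
    by rewrite ler1n.
  by exists K'; split=> //; exact: le_trans K'K Kc.
have uC m : lipschitz_curve C (u m) by have [] := uP m.
have uB m : forall i t, enorm (u m i t) <= B by have [] := uP m.
have Lu m : link_homotopy_class L (u m) by have [[]] := uP m.
have uthick m : (1 <= link_thickness (u m))%E by have [[]] := uP m.
have [U [UU ooU]] := ultraFilterLemma eventually_filter.
have /choice[l' l'P] (p : 'I_n * R) : exists x : 'rV[R]_3, u m p.1 p.2 @[m --> U] --> x.
  by apply: (bounded_ultra_cvg (B := B)) => // m; exact: uB.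
have ul i t : u m i t @[m --> U] --> l' (i, t) by exact: l'P (i, t).
pose L0 := limit_curve uC UU (l := fun i t => l' (i, t)) ul.
exists L0; split.
- exact: limit_class.
- exact: limit_thick.
- move=> K LK Kthick; apply: le_trans (ell_le K (conj LK Kthick)); rewrite cE.
  apply: limit_length => e e0; apply: ooU.
  have := near_infty_natSinv_lt (PosNum e0); apply: filterS => m me.
  have [_ uc _ _] := uP m; apply: le_trans uc _.
  by rewrite lee_fin lerD2l ltW.
Qed.
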